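(* Let the discrete Heisenberg group $H$ act via homeomorphisms on a compact metric space $(X,\rho)$. If $X$ is infinite, then the vertical axis $\mathcal Z=\{(0,u):u\in\mathbb R\}\subset\mathcal H$ is not expansive.
   Context: Let $D\ge 1$ be an integer and let $\{e_i,f_i\}_{i=1}^D$ be the standard basis of $\mathbb R^{2D}$. For $v=\sum_i(p_ie_i+q_if_i)$ and $\tilde v=\sum_i(\tilde p_ie_i+\tilde q_if_i)$ put $\omega(v,\tilde v)=\sum_{i=1}^D(p_i\tilde q_i-q_i\tilde p_i)$. The Heisenberg group is $\mathcal H=\{(v,u):v\in\mathbb R^{2D},u\in\mathbb R\}$ with operation $(v,u)\cdot(\tilde v,\tilde u)=(v+\tilde v,\,u+\tilde u+\tfrac12\omega(v,\tilde v))$ and neutral element $\mathbf 0=(0,0)$. The discrete Heisenberg group $H$ is the subgroup of $\mathcal H$ generated by $x_i=(e_i,0)$ and $y_i=(f_i,0)$, $i=1,\dots,D$. For $r>0$ the dilation is $\delta_r(v,u)=(rv,r^2u)$. A metric $d$ on $\mathcal H$ is homogeneous if $d(gf,hf)=d(g,h)$ and $d(\delta_rg,\delta_rh)=r\,d(g,h)$ for all $g,h,f\in\mathcal H$, $r>0$. A homogeneous metric $d$ on $\mathcal H$ is fixed. For $A\subset\mathcal H$ and $t\ge0$, $A^t=\{g\in\mathcal H: d(g,A)\le t\}$, where $d(g,A)=\inf\{d(g,h):h\in A\}$. $H$ acts via homeomorphisms on $X$ means: there is a group action $(g,x)\mapsto gx$ of $H$ on $X$, $(g_1g_2)x=g_1(g_2x)$,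 with each map $x\mapsto gx$ a homeomorphism. For $A\subset\mathcal H$ and $x,y\in X$ put $\rho^A(x,y)=\sup\{\rho(gx,gy):g\in A\cap H\}$. A set $A\subset\mathcal H$ is expansive if there exist $\varepsilon>0$ and $t>0$ such that for all $x,y\in X$, $\rho^{A^t}(x,y)\le\varepsilon$ implies $x=y$; otherwise $A$ is nonexpansive. *)

(* Defs.v *)
From HB Require Import structures.
From mathcomp Require Import all_boot all_order all_algebra.
From mathcomp Require Import all_classical all_reals all_analysis.

Set Implicit Arguments.
Unset Strict Implicit.
Unset Printing Implicit Defensive.

Import Order.TTheory GRing.Theory Num.Theory.
Import numFieldNormedType.Exports.

Local Open Scope classical_set_scope.
Local Open Scope ring_scope.

Section SymplecticForm.
Context {R : realType} {D : nat}.

(* e_i and f_i are the basis vectors of indices lshift D i and rshift D i. *)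
Definition omega (v w : 'rV[R]_(D + D)) : R :=
  \sum_(i < D) (v 0 (lshift D i) * w 0 (rshift D i)
                - v 0 (rshift D i) * w 0 (lshift D i)).

Lemma omegaDl u v w : omega (u + v) w = omega u w + omega v w.
Proof.
rewrite /omega -big_split /=; apply: eq_bigr => i _.
by rewrite !mxE !mulrDl opprD addrACA.
Qed.

Lemma omegaDr u v w : omega u (v + w) = omega u v + omega u w.
Proof.
rewrite /omega -big_split /=; apply: eq_bigr => i _.
by rewrite !mxE !mulrDr opprD addrACA.
Qed.

Lemma omega0l v : omega 0 v = 0.
Proof. by apply: big1 => i _; rewrite !mxE !mul0r subr0. Qed.

Lemma omega0r v : omega v 0 = 0.
Proof. by apply: big1 => i _; rewrite !mxE !mulr0 subr0. Qed.

Lemma omegavv v : omega v v = 0.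
Proof. by apply: big1 => i _; rewrite mulrC subrr. Qed.

Lemma omegaNl v w : omega (- v) w = - omega v w.
Proof. by apply/eqP; rewrite -addr_eq0 -omegaDl addNr omega0l. Qed.

Lemma omegaNr v w : omega v (- w) = - omega v w.
Proof. by apply/eqP; rewrite -addr_eq0 -omegaDr addNr omega0r. Qed.

End SymplecticForm.

(* A dedicated record, because a product type would come with the abelian
   componentwise structure. *)
Record heis (R : realType) (D : nat) :=
  Heis { hvec : 'rV[R]_(D + D); hcen : R }.

Section HeisenbergGroup.
Context {R : realType} {D : nat}.
Implicit Types g h : heis R D.

Definition heis_pair g := (hvec g, hcen g).
Definition pair_heis (p : 'rV[R]_(D + D) * R) := Heis p.1 p.2.
Lemma heis_pairK : cancel heis_pair pair_heis. Proof. by case. Qed.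

HB.instance Definition _ := Choice.copy (heis R D) (can_type heis_pairK).

Definition heis_one : heis R D := Heis 0 0.

Definition heis_mul g h : heis R D :=
  Heis (hvec g + hvec h) (hcen g + hcen h + 2^-1 * omega (hvec g) (hvec h)).

Definition heis_inv g : heis R D := Heis (- hvec g) (- hcen g).

Fact heis_mulA : associative heis_mul.
Proof.
move=> [a r] [b s] [c t]; rewrite /heis_mul /= addrA; congr Heis.
rewrite omegaDl omegaDr !mulrDr -!addrA; congr (_ + (_ + _)).
by rewrite [RHS]addrCA; congr (_ + _); rewrite [LHS]addrC -!addrA.
Qed.

Fact heis_mul1g : left_id heis_one heis_mul.
Proof.
by move=> [v u]; rewrite /heis_mul /= omega0l mulr0 addr0 !add0r.
Qed.

Fact heis_mulg1 : right_id heis_one heis_mul.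
Proof. by move=> [v u]; rewrite /heis_mul /= omega0r mulr0 !addr0. Qed.

Fact heis_mulVg : left_inverse heis_one heis_inv heis_mul.
Proof.
move=> [v u].
by rewrite /heis_mul /= omegaNl omegavv oppr0 mulr0 addr0 !addNr.
Qed.

Fact heis_mulgV : right_inverse heis_one heis_inv heis_mul.
Proof.
move=> [v u].
by rewrite /heis_mul /= omegaNr omegavv oppr0 mulr0 addr0 !subrr.
Qed.

HB.instance Definition _ := isGroup.Build (heis R D)
  heis_mulA heis_mul1g heis_mulg1 heis_mulVg heis_mulgV.

Definition dilation (r : R) g : heis R D := Heis (r *: hvec g) (r ^+ 2 * hcen g).

Definition vertical_axis : set (heis R D) := range (Heis 0).

End HeisenbergGroup.

Arguments vertical_axis : clear implicits.

Section GeneratedSubgroup.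
Context {G : groupType}.

Definition is_subgroup (S : set G) : Prop := group_closed (mem S).

Definition generated_subgroup (A : set G) : set G := smallest is_subgroup A.

Lemma generated_subgroup_closed (A : set G) : is_subgroup (generated_subgroup A).
Proof.
split; first by apply/mem_set => B [[B1 _] _]; exact/set_mem.
move=> x y /set_mem xA /set_mem yA; apply/mem_set => B HB.
have [[_ Bd] _] := HB.
by apply/set_mem/Bd; apply/mem_set; [exact: xA | exact: yA].
Qed.

End GeneratedSubgroup.

Section DiscreteHeisenberg.
Variables (R : realType) (D : nat).

Definition heis_x (i : 'I_D) : heis R D := Heis (delta_mx 0 (lshift D i)) 0.
Definition heis_y (i : 'I_D) : heis R D := Heis (delta_mx 0 (rshift D i)) 0.

Definition discrete_heis : set (heis R D) :=
  generated_subgroup (range heis_x `|` range heis_y).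

Definition dheis : Type := set_type discrete_heis.

HB.instance Definition _ := SubChoice.on dheis.
HB.instance Definition _ := SubChoice_isSubGroup.Build (heis R D)
  (mem discrete_heis) dheis (generated_subgroup_closed _).

End DiscreteHeisenberg.

Section HomogeneousMetric.
Context {R : realType} {D : nat}.
Implicit Types (d : heis R D -> heis R D -> R) (g h f : heis R D).

Record is_metric (T : Type) (d : T -> T -> R) : Prop := IsMetric {
  metric_ge0 : forall x y, 0 <= d x y;
  metric_eq0 : forall x y, d x y = 0 <-> x = y;
  metric_symmetric : forall x y, d x y = d y x;
  metric_triangular : forall x y z, d x z <= d x y + d y z
}.

Record homogeneous_metric d : Prop := HomogeneousMetric {
  homogeneous_is_metric : is_metric d;
  homogeneous_right_invariant : forall g h f, d (g * f)%g (h * f)%g = d g h;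
  homogeneous_dilation : forall g h (r : R), 0 < r ->
    d (dilation r g) (dilation r h) = r * d g h
}.

(* The infimum is taken in the extended reals, so that the distance to the
   empty set is +oo. *)
Definition dist_to d g (A : set (heis R D)) : \bar R :=
  ereal_inf [set (d g h)%:E | h in A].

Definition thickening d (A : set (heis R D)) (t : R) : set (heis R D) :=
  [set g | (dist_to d g A <= t%:E)%E].

End HomogeneousMetric.

Definition homeomorphism (X Y : topologicalType) (f : X -> Y) : Prop :=
  exists f' : Y -> X, [/\ cancel f f', cancel f' f, continuous f & continuous f'].

Record acts_by_homeomorphisms (G : groupType) (X : topologicalType)
    (act : G -> X -> X) : Prop := ActsByHomeomorphisms {
  act_one : forall x, act 1%g x = x;
  act_mul : forall g1 g2 x, act (g1 * g2)%g x = act g1 (act g2 x);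
  act_homeo : forall g, homeomorphism (act g)
}.

Section Expansiveness.
Context {R : realType} {D : nat} {X : metricType R}.
Variables (d : heis R D -> heis R D -> R) (act : dheis R D -> X -> X).

Definition rho_sup (A : set (heis R D)) (x y : X) : \bar R :=
  ereal_sup [set (mdist (act g x) (act g y))%:E |
    g in [set g : dheis R D | A (val g)]].

Definition expansive (A : set (heis R D)) : Prop :=
  exists eps t : R, [/\ 0 < eps, 0 < t &
    forall x y : X, (rho_sup (thickening d A t) x y <= eps%:E)%E -> x = y].

End Expansiveness.

(* Main.v *)
(* The point z = (0,1) is central, and [x^n, y^n] = z^(n^2).  If the vertical
   axis were expansive, then z would act expansively with respect to some closed
   neighbourhood U of the diagonal: a thickening of the axis meets H in finitely
   many cosets of <z>.  By compactness each g in H then has a radius c: if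
   (z^j p, z^j q) lies in U for |j| <= c, then (g p, g q) lies in U.  Radii are
   subadditive, so z^(n^2), and likewise its inverse, has a radius linear in n.
   For n large that radius is below n^2, and agreement of p and q on a fixed
   window of exponents j propagates to all j, forcing p = q.  So X is discrete,
   hence finite. *)
Require Import Defs.
From mathcomp Require Import all_boot all_order all_algebra.
From mathcomp Require Import all_classical all_reals all_analysis.
From mathcomp Require Import zify ring lra.

Set Implicit Arguments.
Unset Strict Implicit.
Unset Printing Implicit Defensive.

Import Order.TTheory GRing.Theory Num.Theory.
Import numFieldNormedType.Exports.

Local Open Scope classical_set_scope.
Local Open Scope ring_scope.

(** * Compact discrete spaces, and propagation along the integers *)

Lemma compact_discrete_finite (X : topologicalType) :
  compact [set: X] -> (forall x : X, nbhs x [set x]) -> finite_set [set: X].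
Proof.
move=> cX X1; apply: contrapT => Xinf.
(* The cofinite filter, proper when [X] is infinite, clusters at no [p]: the neighbourhood [[set p]]
   misses its own cofinite complement. *)
pose F : set_system X := [set A | finite_set (~` A)].
have FF : Filter F.
  split=> [|A B|A B AB]; rewrite /F /=.
  - by rewrite setCT.
  - by rewrite setCI finite_setU.
  - by apply: sub_finite_set; exact: subsetC.
have PF : ProperFilter F.
  apply: Build_ProperFilter_ex => A /= FA.
  by apply/set0P/eqP => A0; apply: Xinf; rewrite -setC0 -A0.
have [p [_ clp]] := cX F PF filterT.
by have [|q []] := clp (~` [set p]) [set p] _ (X1 p); rewrite /F /= ?setCK.
Qed.

(** The known window grows by one on each side per step: a new index is [N + k] or [- N + k], and
    [c < N] keeps the radius-[c] window around [k] inside the known one. *)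
Lemma int_propagate (P : int -> Prop) (c N : nat) : (c < N)%N ->
    (forall k, (forall j : int, (`|j| <= c)%N -> P (j + k)) ->
       P (N%:Z + k) /\ P (- N%:Z + k)) ->
  (forall j : int, (`|j| <= c + N)%N -> P j) -> forall k, P k.
Proof.
move=> cN PN P0 k.
suff H n : forall j : int, (`|j| <= c + N + n)%N -> P j by apply: (H `|k|%N); lia.
elim: n => [|n IHn] j jn; first by apply: P0; lia.
have [/IHn//|jn'] := leqP `|j|%N (c + N + n).
have [j0|j0] := leP 0 j.
- have [|+ _] := PN (j - N%:Z); last by rewrite addrC subrK.
  by move=> i ic; apply: IHn; lia.
- have [|_] := PN (j + N%:Z); last by rewrite addrC addrK.
  by move=> i ic; apply: IHn; lia.
Qed.

Lemma pair_map_continuous (X Y : topologicalType) (f : X -> Y) :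
  continuous f -> continuous (fun w : X * X => (f w.1, f w.2)).
Proof.
move=> cf [p q]; apply: cvg_pair.
- by apply: (@continuous_comp _ _ _ fst f); [exact: cvg_fst|exact: cf].
- by apply: (@continuous_comp _ _ _ snd f); [exact: cvg_snd|exact: cf].
Qed.

(** * Group actions that are expansive along a central copy of the integers *)

Section CentralExpansiveness.
Context {G : groupType} {X : topologicalType} (act : G -> X -> X).
Hypothesis cX : compact [set: X].
Hypothesis hact : acts_by_homeomorphisms act.

Let act2 g (w : X * X) := (act g w.1, act g w.2).

Let act2M g h w : act2 (g * h)%g w = act2 g (act2 h w).
Proof. by rewrite /act2 !(act_mul hact). Qed.

Let act_continuous g : continuous (act g).
Proof. by have [f' []] := act_homeo hact g. Qed.

Let act2_continuous g : continuous (act2 g).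
Proof. exact: pair_map_continuous. Qed.

Variable z : int -> G.
Hypothesis z0 : z 0 = 1%g.
Hypothesis zD : forall j k : int, z (j + k) = (z j * z k)%g.
Hypothesis zC : forall k g, commute g (z k).
Variable U : set (X * X).
Hypothesis clU : closed U.
Hypothesis diagU : forall p : X, nbhs (p, p) U.
Hypothesis Uexp : forall p q, (forall k, U (act2 (z k) (p, q))) -> p = q.

(* For a symbolic action this says that [g] acts by a block code of radius [c]. *)
Let radius (c : nat) g := forall w,
  (forall j : int, (`|j| <= c)%N -> U (act2 (z j) w)) -> U (act2 g w).

(** If all windows failed, the counterexamples [w m] would cluster at some [(p, q)]. Closedness of
    [U] keeps the whole [z]-orbit of [(p, q)] in [U], so [p = q]; but [g] sends a neighbourhood of
    [(p, p)] into [U], against [~ U (act2 g (w m))]. *)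
Let radius_exists g : exists c, radius c g.
Proof.
apply/not_existsP => noc.
have {noc} /choice[w wP] m : exists w,
    (forall j : int, (`|j| <= m)%N -> U (act2 (z j) w)) /\ ~ U (act2 g w).
  by have /existsNP[w /not_implyP] := noc m; exists w.
have cXX : compact [set: X * X] by rewrite -setXTT; exact: compact_setX.
have [[p q] [_ pq]] := cXX (w @ \oo) _ filterT.
have pqE : p = q.
  apply: Uexp => k; have clk : closed (act2 (z k) @^-1` U).
    by apply: preimage_closed => // ? _; exact: act2_continuous.
  apply: clk => B nB; apply: (pq _ _ _ nB).
  by exists `|k|%N => // m /= km; apply: (wP m).1.
rewrite -{q}pqE in pq.
have nV : nbhs (p, p) (act2 g @^-1` U) by apply: act2_continuous; exact: diagU.
have [] := pq (~` (act2 g @^-1` U)) _ _ nV.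
- by exists 0%N => // m _; exact: (wP m).2.
- by move=> v [].
Qed.

Let radius_le c c' g : (c <= c')%N -> radius c g -> radius c' g.
Proof. by move=> cc' + w wU => /(_ w); apply=> j jc; apply: wU; lia. Qed.

Let radius1 : radius 0 1%g.
Proof. by move=> w wU; rewrite -z0; exact: wU. Qed.

(** Centrality moves [z j] past [h], so the windows of [g] and [h] add up. *)
Let radiusM c c' g h : radius c g -> radius c' h -> radius (c + c') (g * h)%g.
Proof.
move=> gc hc' w wU; rewrite act2M; apply: gc => j jc.
rewrite -act2M -zC act2M; apply: hc' => i ic'.
by rewrite -act2M -zD; apply: wU; lia.
Qed.

Let radiusX c g n : radius c g -> radius (n * c) (g ^+ n)%g.
Proof.
move=> gc; elim: n => [|n IHn]; first exact: radius1.
by rewrite expgS mulSn; exact: radiusM.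
Qed.

Lemma central_commutator_not_expansive (x y : G) :
  (forall n, [~ x ^+ n, y ^+ n]%g = z (n ^ 2)%N) -> finite_set [set: X].
Proof.
move=> xyz.
have [m [xm ym xVm yVm]] : exists m,
    [/\ radius m x, radius m y, radius m x^-1%g & radius m y^-1%g].
  have [a xa] := radius_exists x; have [b yb] := radius_exists y.
  have [a' xa'] := radius_exists x^-1%g; have [b' yb'] := radius_exists y^-1%g.
  exists (a + b + (a' + b'))%N.
  by split; [apply: radius_le xa|apply: radius_le yb|apply: radius_le xa'|
             apply: radius_le yb']; lia.
(* Each of the four powers in the commutator has radius [n * m], so [c] is [4 * n * m], which is
   below [n ^ 2] once [n > 4 * m]. *)
pose n := (4 * m).+1; pose c := (n * m + (n * m + (n * m + n * m)))%N.
have zE : z (n ^ 2)%N = (x^-1 ^+ n * (y^-1 ^+ n * (x ^+ n * y ^+ n)))%g.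
  by rewrite -xyz !expVgn /commg /conjg !mulgA.
(* Exchanging [x] and [y] inverts the commutator; this serves propagation towards negative
   indices. *)
have zVE : z (- (n ^ 2)%N%:Z) = (y^-1 ^+ n * (x^-1 ^+ n * (y ^+ n * x ^+ n)))%g.
  apply: (mulIg (z (n ^ 2)%N)); rewrite -zD addNr z0 zE !expVgn -!mulgA.
  by rewrite mulVKg mulVKg mulKg mulVg.
have zc : radius c (z (n ^ 2)%N).
  by rewrite zE; do !apply: radiusM; exact: radiusX.
have zVc : radius c (z (- (n ^ 2)%N%:Z)).
  by rewrite zVE; do !apply: radiusM; exact: radiusX.
have cn : (c < n ^ 2)%N by rewrite /c /n; nia.
have zM p q : (forall j : int, (`|j| <= c + n ^ 2)%N -> U (act2 (z j) (p, q))) ->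
    p = q.
  move=> pqU; apply: Uexp; apply: (int_propagate cn) pqU => k kU.
  by rewrite !zD !act2M; split; [apply: zc|apply: zVc] => j jc;
    rewrite -act2M -zD; exact: kU.
apply: compact_discrete_finite => // p.
(* By [zM], finitely many conditions on [q], each valid near [p], force [q = p]. Subtracting
   [c + n ^ 2] makes [i] run over the whole symmetric window. *)
have : nbhs p (fun q => forall i : 'I_(c + n ^ 2).*2.+1,
    U (act2 (z (i%:Z - (c + n ^ 2)%N%:Z)) (p, q))).
  apply: filter_forall => i; set k := (_ - _).
  have pk : (fun q => act2 (z k) (p, q)) @ p --> act2 (z k) (p, p).
    apply: (@continuous_comp _ _ _ (pair p) (act2 (z k))); last first.
      exact: act2_continuous.
    by apply: cvg_pair; [exact: cvg_cst|exact: cvg_id].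
  by apply: pk; exact: diagU.
apply: filterS => q qU; apply/esym; apply: zM => j jc.
have jO : (`|(j + (c + n ^ 2)%N%:Z)%R| < (c + n ^ 2).*2.+1)%N by lia.
suff <- : (Ordinal jO)%:Z - (c + n ^ 2)%N%:Z = j by exact: qU.
by rewrite /=; lia.
Qed.

End CentralExpansiveness.

(** * Commutators and integrality in the Heisenberg group *)

Section Heisenberg.
Context {R : realType} {D : nat}.
Implicit Types (g h : heis R D) (v w : 'rV[R]_(D + D)).

Lemma omegaC v w : omega v w = - omega w v.
Proof. by rewrite /omega -sumrN; apply: eq_bigr => i _; ring. Qed.

Lemma omegaMnl v w n : omega (v *+ n) w = omega v w *+ n.
Proof.
by elim: n => [|n IHn]; rewrite ?mulr0n ?omega0l// !mulrS omegaDl IHn.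
Qed.

Lemma omegaMnr v w n : omega v (w *+ n) = omega v w *+ n.
Proof. by rewrite omegaC omegaMnl -mulNrn -omegaC. Qed.

Lemma omega_delta_lshift v (i : 'I_D) :
  omega v (delta_mx 0 (lshift D i)) = - v 0 (rshift D i).
Proof.
rewrite /omega (bigD1 i)//= !mxE !eqxx eq_rlshift mulr0 mulr1 sub0r.
rewrite big1 ?addr0// => j ji.
by rewrite !mxE eq_rlshift eq_lshift (negPf ji) !mulr0 subr0.
Qed.

Lemma omega_delta_rshift v (i : 'I_D) :
  omega v (delta_mx 0 (rshift D i)) = v 0 (lshift D i).
Proof.
rewrite /omega (bigD1 i)//= !mxE !eqxx eq_lrshift mulr0 mulr1 subr0.
rewrite big1 ?addr0// => j ji.
by rewrite !mxE eq_lrshift eq_rshift (negPf ji) !mulr0 subr0.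
Qed.

Lemma heis_mulE g h :
  (g * h)%g = Heis (hvec g + hvec h) (hcen g + hcen h + 2^-1 * omega (hvec g) (hvec h)).
Proof. by []. Qed.

Lemma heis_invE g : g^-1%g = Heis (- hvec g) (- hcen g).
Proof. by []. Qed.

Lemma heis_expE g n : (g ^+ n)%g = Heis (hvec g *+ n) (hcen g *+ n).
Proof.
elim: n => [//|n IHn]; rewrite expgS IHn heis_mulE /= -!mulrS.
by rewrite omegaMnr omegavv mul0rn mulr0 addr0.
Qed.

Lemma heis_commE g h : [~ g, h]%g = Heis 0 (omega (hvec g) (hvec h)).
Proof.
rewrite /commg /conjg !heis_mulE !heis_invE /=; congr Heis.
  by rewrite [- _ + (_ + _)]addrCA addKr addrC subrr.
rewrite !(omegaDl, omegaDr, omegaNl, omegaNr, omegavv).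
rewrite (omegaC (hvec h) (hvec g)); by field.
Qed.

Lemma heis_center_commute (u : R) g : commute g (Heis 0 u).
Proof.
rewrite /commute !heis_mulE /=; congr Heis; first by rewrite addrC.
by rewrite omega0l omega0r; ring.
Qed.

(** The factor 2 absorbs the [2^-1] by which products of integer vectors enter the centre. *)
Definition int_heis : set (heis R D) :=
  [set g | (forall j, hvec g 0 j \is a Num.int) /\ 2 * hcen g \is a Num.int].

Lemma int_heis_subgroup : is_subgroup int_heis.
Proof.
split; first by apply/mem_set; split => [j|] /=; rewrite ?mxE ?mulr0 ?rpred0.
move=> g h /set_mem[gv gc] /set_mem[hv hc]; apply/mem_set; split => [j|] /=.
  by rewrite !mxE rpredB.
rewrite omegaNr mulrDr mulrDr mulrN mulrA divff// mul1r.
rewrite rpredB ?rpredD ?rpredN//.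
by apply: rpred_sum => i _; rewrite rpredB ?rpredM.
Qed.

Lemma discrete_heis_int : @discrete_heis R D `<=` int_heis.
Proof.
move=> g; apply; split; first exact: int_heis_subgroup.
by move=> _ [] [i _ <-]; split=> [j|] /=; rewrite ?mxE ?mulr0 ?rpred0 ?rpred_nat.
Qed.

(** Provides finitely many representatives modulo powers of [(0, 1)]: the entries are bounded
    integers, and [hcen] in [[0, 1)] can only be 0 or 1/2. *)
Lemma discrete_heis_box_finite (B : R) :
  finite_set [set g : dheis R D | (forall j, `|hvec (val g) 0 j| <= B) /\
                                  0 <= hcen (val g) < 1].
Proof.
pose b := Num.bound B.
pose f (x : {ffun 'I_(D + D) -> 'I_b.*2.+1} * bool) : heis R D :=
  Heis (\row_j ((x.1 j)%:R - b%:R)) ((x.2 : nat)%:R / 2).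
apply: (@sub_finite_set _ _ (val @^-1` range f)); last first.
  by apply: finite_preimage; [move=> ? ? _ _; exact: val_inj|exact: finite_image].
move=> g /= [gB /andP[g0 g1]].
have [gv /intrP[m mE]] : int_heis (sval g) := discrete_heis_int (set_valP g).
have mm : m = 0 \/ m = 1.
  have : 0 <= (m%:~R : R) < 2 by rewrite -mE; apply/andP; split; lra.
  by rewrite ler0z -[2]/(2%:~R) ltr_int; lia.
have /choice[a aE] : forall j, exists k : 'I_b.*2.+1, hvec (sval g) 0 j = k%:R - b%:R.
  move=> j; have /intrP[k kE] := gv j.
  have : `|hvec (sval g) 0 j| < b%:R.
    apply: le_lt_trans (gB j) _; apply: archi_boundP.
    exact: le_trans (gB j).
  rewrite kE -intr_norm -[b%:R]/(b%:~R) ltr_int => kb.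
  have kO : (`|(k + b%:Z)%R| < b.*2.+1)%N by lia.
  exists (Ordinal kO); rewrite /= !pmulrn -intrB; congr (_%:~R); lia.
exists ([ffun j => a j], m == 1) => //.
rewrite /f; case: (sval g) mE aE => /= v u mE aE; congr Heis.
  by apply/rowP => j; rewrite !mxE ffunE aE.
by case: mm mE => -> /= mE; lra.
Qed.

Lemma heis_x_dheis (i : 'I_D) : discrete_heis (heis_x R i).
Proof. by move=> B [_]; apply; left; exists i. Qed.

Lemma heis_y_dheis (i : 'I_D) : discrete_heis (heis_y R i).
Proof. by move=> B [_]; apply; right; exists i. Qed.

End Heisenberg.

(** * Homogeneous metrics near the vertical axis *)

Section HomogeneousGauge.
Context {R : realType} {D : nat} {d : heis R D -> heis R D -> R}.
Hypothesis hd : homogeneous_metric d.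
Implicit Types (g h : heis R D).

Let dm := homogeneous_is_metric hd.
Let N g := d g 1%g.

Let NM g h : N (g * h)%g <= N g + N h.
Proof.
apply: le_trans (metric_triangular dm _ h _) _.
by rewrite -{2}(mul1g h) (homogeneous_right_invariant hd).
Qed.

Let NV g : N g^-1%g = N g.
Proof.
by rewrite /N -(homogeneous_right_invariant hd _ _ g) mulVg mul1g (metric_symmetric dm).
Qed.

Let Ncomm g h : N [~ g, h]%g <= 2 * (N g + N h).
Proof.
rewrite /commg /conjg; have := NM g^-1%g (h^-1 * (g * h))%g.
have := NM h^-1%g (g * h)%g; have := NM g h; rewrite !NV; lra.
Qed.

Let Ncenter (u : R) : 0 < u -> N (Heis 0 u) = Num.sqrt u * N (Heis 0 1).
Proof.
move=> u0; have su : 0 < Num.sqrt u by rewrite sqrtr_gt0.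
rewrite /N -(homogeneous_dilation hd _ _ su); congr d; rewrite /dilation /= ?scaler0.
  by rewrite sqr_sqrtr ?mulr1// ltW.
by rewrite mulr0.
Qed.

Let Ncenter1_gt0 : 0 < N (Heis 0 1).
Proof.
rewrite lt_neqAle (metric_ge0 dm) andbT; apply/eqP => /esym/(metric_eq0 dm).
by case=> /eqP; rewrite oner_eq0.
Qed.

(* [N (0, u)] grows like the square root of [u], so the size of the commutator
   [(0, omega v w)] controls [omega v w]. *)
Let omega_bound g h :
  `|omega (hvec g) (hvec h)| <= (2 * (N g + N h) / N (Heis 0 1)) ^+ 2.
Proof.
(* [Ncenter] needs a positive argument; exchanging [g] and [h] flips the sign of [omega]. *)
wlog o0 : g h / 0 < omega (hvec g) (hvec h) => [hw|].
  have [|o0|<-] := ltgtP 0 (omega (hvec g) (hvec h)); first exact: hw.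
    by rewrite omegaC normrN [N g + _]addrC; apply: hw; rewrite omegaC oppr_gt0.
  by rewrite normr0 sqr_ge0.
rewrite gtr0_norm// -{1}(sqr_sqrtr (ltW o0)) lerXn2r ?nnegrE ?sqrtr_ge0//.
  by rewrite divr_ge0 ?(metric_ge0 dm)// mulr_ge0// addr_ge0 ?(metric_ge0 dm).
by rewrite ler_pdivlMr// -Ncenter// -heis_commE.
Qed.

(** Translating [g] by a central element brings it near the identity without changing [hvec g]; then
    [omega_bound] against basis vectors bounds each coordinate. *)
Lemma vertical_thickening_bounded (t : R) : exists B : R,
  forall g, thickening d (vertical_axis R D) t g -> forall j, `|hvec g 0 j| <= B.
Proof.
pose e (j : 'I_(D + D)) : heis R D := Heis (delta_mx 0 j) 0.
pose S := \sum_j N (e j).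
exists ((2 * ((t + 1) + S) / N (Heis 0 1)) ^+ 2) => g gt j.
(* The infimum need not be attained, so an actual point of the axis is found only within [t + 1]. *)
have [_ [_ [u _ <-] <-]] : exists2 x, [set (d g h)%:E | h in vertical_axis R D] x &
    (x < (t + 1)%:E)%E.
  by apply: ereal_inf_lt; apply: le_lt_trans gt _; rewrite lte_fin ltrDl.
rewrite lte_fin => du; pose g' := (g * Heis 0 (- u))%g.
have g'v : hvec g' = hvec g by rewrite /= addr0.
have Ng' : N g' <= t + 1.
  rewrite /N (_ : 1%g = Heis 0 u * Heis 0 (- u))%g; last first.
    by rewrite heis_mulE /= omega0l mulr0 !addr0 subrr.
  by rewrite (homogeneous_right_invariant hd) ltW.
have eS k : N (e k) <= S.
  by rewrite /S (bigD1 k)//= lerDl sumr_ge0// => i _; exact: (metric_ge0 dm).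
have [k ->] : exists k, `|hvec g 0 j| = `|omega (hvec g') (hvec (e k))|.
  rewrite g'v; case: (split_ordP j) => i ->.
    by exists (rshift D i); rewrite /= omega_delta_rshift.
  by exists (lshift D i); rewrite /= omega_delta_lshift normrN.
apply: le_trans (omega_bound _ _) _.
have N0 h : 0 <= N h := metric_ge0 dm _ _.
have tS : N g' + N (e k) <= t + 1 + S by exact: lerD.
have le0 := addr_ge0 (N0 g') (N0 (e k)).
rewrite lerXn2r ?nnegrE ?divr_ge0 ?mulr_ge0//; first exact: le_trans tS.
by rewrite ler_pM2r ?invr_gt0// ler_pM2l.
Qed.

End HomogeneousGauge.

Lemma closed_mdist_le (R : realType) (X : metricType R) (e : R) :
  closed [set w : X * X | mdist w.1 w.2 <= e].
Proof.
move=> [p q] clpq /=; apply/ler_addgt0Pr => r r0.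
have [|[p' q'] /= [pq' [pp' qq']]] := clpq (ball p (r / 2) `*` ball q (r / 2)).
  by exists (ball p (r / 2), ball q (r / 2)) => //; split; apply: nbhsx_ballx; lra.
move: pp' qq'; rewrite !ballEmdist /= => pp' qq'.
have := metric_triangle p p' q; have := metric_triangle p' q' q.
by rewrite [mdist q' q]metric_sym; lra.
Qed.

(** * The discrete group and the vertical axis *)

Section DiscreteValues.
Context {R : realType} {D : nat}.
Implicit Types g h : dheis R D.

(* The generic morphism lemmas for [val] leave it in the form of a packed
   morphism, on which later rewriting with [val] fails. *)
Lemma dheis_valM g h : val (g * h)%g = (val g * val h)%g.
Proof. exact: gmulfM. Qed.

Lemma dheis_valX g n : val (g ^+ n)%g = (val g ^+ n)%g.
Proof. exact: gmulfXn. Qed.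

Lemma dheis_valV g : val g^-1%g = (val g)^-1%g.
Proof. exact: gmulfV. Qed.

Lemma dheis_valR g h : val [~ g, h]%g = [~ val g, val h]%g.
Proof. exact: gmulfR. Qed.

End DiscreteValues.

Lemma dheis_center (R : realType) (D : nat) (i : 'I_D) (k : int) :
  exists z : dheis R D, val z = Heis 0 k%:~R.
Proof.
pose x : dheis R D := Sub (heis_x R i) (mem_set (heis_x_dheis i)).
pose y : dheis R D := Sub (heis_y R i) (mem_set (heis_y_dheis i)).
have z1E : val [~ x, y]%g = Heis 0 1.
  by rewrite dheis_valR heis_commE /= omega_delta_rshift mxE !eqxx.
case: k => n; [exists ([~ x, y] ^+ n)%g|exists ([~ x, y] ^- n.+1)%g].
  by rewrite dheis_valX z1E heis_expE /= mul0rn -pmulrn.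
by rewrite dheis_valV dheis_valX z1E heis_expE heis_invE /= mul0rn oppr0 NegzE intrN -pmulrn.
Qed.

Theorem theorem5p1 (R : realType) (D : nat) (hD : (1 <= D)%N)
  (d : heis R D -> heis R D -> R) (hd : homogeneous_metric d)
  (X : metricType R) (hX : compact [set: X]%classic)
  (act : dheis R D -> X -> X) (hact : acts_by_homeomorphisms act)
  (Xinf : infinite_set [set: X]%classic) :
  ~ expansive d act (vertical_axis R D).
Proof.
move=> [eps [t [eps0 t0 expand]]]; apply: Xinf.
pose i := Ordinal hD.
have /choice[z zE] := dheis_center R i.
have [B BP] := vertical_thickening_bounded hd t.
(* [F] represents every coset of the powers of [z] that meets the thickening; [U] collects the pairs
   that stay [eps]-close under all of [F]. *)
pose F := [set g : dheis R D | (forall j, `|hvec (val g) 0 j| <= B) /\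
                               0 <= hcen (val g) < 1].
pose U := \bigcap_(g in F) [set w : X * X | mdist (act g w.1) (act g w.2) <= eps].
have act_cont g : continuous (act g) by have [? []] := act_homeo hact g.
have act2_cont g : continuous (fun w : X * X => (act g w.1, act g w.2)).
  exact: pair_map_continuous.
have clU : closed U.
  apply: closed_bigI => g _.
  exact: preimage_closed (in1W (@act2_cont g)) (@closed_mdist_le _ X eps).
have diagU (p : X) : nbhs (p, p) U.
  (* Finiteness of [F] makes the intersection of neighbourhoods a neighbourhood. *)
  have /finite_fsetP[F' FE] : finite_set F by exact: discrete_heis_box_finite.
  rewrite /U FE; apply: filter_bigI => g _.
  suff : \forall w \near (act g p, act g p), mdist w.1 w.2 <= eps.
    exact: (@act2_cont g (p, p)).
  exists (ball (act g p) (eps / 2), ball (act g p) (eps / 2)).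
    by split; apply: nbhsx_ballx; lra.
  move=> [a b] [] /=; rewrite !ballEmdist /= => pa pb.
  have := metric_triangle a (act g p) b; rewrite [mdist a (act g p)]metric_sym; lra.
apply: (central_commutator_not_expansive hX hact (z := z) _ _ _ clU diagU _
  (x := Sub (heis_x R i) (mem_set (heis_x_dheis i)))
  (y := Sub (heis_y R i) (mem_set (heis_y_dheis i)))).
- by apply: val_inj; rewrite zE gmulf1.
- move=> j k; apply: val_inj; rewrite dheis_valM !zE heis_mulE /= addr0 omega0l mulr0 addr0.
  by rewrite intrD.
- move=> k g; apply: val_inj; rewrite !dheis_valM zE; exact: heis_center_commute.
- move=> p q pqU; apply: expand; apply: ge_ereal_sup => _ [g gt <-].
  (* Taking out [z k] leaves a central coordinate in [[0, 1)] and the same vector part, so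
     [g * z (- k)] lies in [F]. *)
  rewrite lee_fin; pose k := Num.floor (hcen (val g)).
  have gE : g = (g * z (- k) * z k)%g.
    apply: val_inj; rewrite !dheis_valM !zE -mulgA [(Heis _ _ * Heis _ _)%g]heis_mulE /=.
    by rewrite omega0l mulr0 !addr0 intrN addNr mulg1.
  rewrite gE !(act_mul hact _ (z k)); apply: (pqU k); split.
    move=> j; rewrite dheis_valM zE /= addr0; exact: BP.
  rewrite dheis_valM zE /= omega0r mulr0 addr0 intrN subr_ge0 ltrBlDl.
  by rewrite -intrD1 floor_itv.
- move=> n; apply: val_inj; rewrite zE dheis_valR !dheis_valX heis_commE !heis_expE /=.
  rewrite omegaMnl omegaMnr omega_delta_rshift mxE !eqxx -mulrnA -pmulrn.
  by rewrite mulnn.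
Qed.
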